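(* Let $M$ be a multi-path matroid and $\sigma$ a cyclic permutation of its ground set, and let $\mathcal{I}$ be a minimal $\sigma$-interval presentation of $M$. Then every set in $\mathcal{I}$ is a cocircuit of $M$. Consequently, every minimal $\sigma$-interval presentation of a multi-path matroid is a minimal presentation.
   Context: Transversal matroid $M[\mathcal{A}]$ of a multiset $\mathcal{A}=(A_1,\ldots,A_r)$ of subsets of a finite set $S$: its independent sets are the partial transversals. A presentation $(A_1,\ldots,A_r)$ of $M$ contains a presentation $(A'_1,\ldots,A'_r)$ of $M$ if $A'_i\subseteq A_i$ for all $i$; a presentation is minimal if it contains no other presentation of $M$. For a cyclic permutation $\sigma$ of $S$, a $\sigma$-interval is a nonempty set $\{f,\sigma(f),\ldots,l\}$; a $\sigma$-interval presentation is a presentation by an antichain (no member containing another) of $\sigma$-intervals, and it is a minimal $\sigma$-interval presentation if it contains no other $\sigma$-interval presentation of $M$. A multi-path matroid is a transversal matroid having a $\sigma$-interval presentation for some cyclic permutation $\sigma$ of its ground set. *)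

(* Defs.v *)
From HB Require Import structures.
From mathcomp Require Import all_boot all_fingroup.

Set Implicit Arguments.
Unset Strict Implicit.
Unset Printing Implicit Defensive.

(* A matroid whose ground set is the finite type T. *)
Record matroid (T : finType) := Matroid {
  indep : pred {set T};
  indep0 : indep set0;
  indep_sub : forall X Y : {set T}, X \subset Y -> indep Y -> indep X;
  indep_aug : forall X Y : {set T}, indep X -> indep Y -> #|X| < #|Y| ->
    exists2 y, y \in Y :\: X & indep (y |: X)
}.

Section MatroidTheory.

Variables (T : finType) (M : matroid T).
Implicit Types B C X Y Z : {set T}.

Definition basis B : bool := maxset (indep M) B.

Definition circuit C : bool := minset (fun X => ~~ indep M X) C.

Lemma indep_extend X Y : indep M X -> indep M Y -> #|X| <= #|Y| ->
  exists Z, [/\ X \subset Z, Z \subset X :|: Y, indep M Z & #|Z| = #|Y|].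
Proof.
move=> + iY; move Dn: (#|Y| - #|X|) => n.
elim: n X Dn => [|n IH] X Dn iX leXY.
  exists X; split=> //; first exact: subsetUl.
  by apply/eqP; rewrite eqn_leq leXY -subn_eq0 Dn.
have ltXY : #|X| < #|Y| by rewrite -subn_gt0 Dn.
have [y /setDP[yY yX] iyX] := indep_aug iX iY ltXY.
have cyX : #|y |: X| = #|X|.+1 by rewrite cardsU1 yX.
have [||Z [sXZ sZ iZ cZ]] := IH (y |: X) _ iyX.
- by rewrite cyX subnS Dn.
- by rewrite cyX.
exists Z; split=> //; first by apply: subset_trans sXZ; apply: subsetUr.
apply: subset_trans sZ _; rewrite !subUset subsetUl subsetUr sub1set.
by rewrite inE yY orbT.
Qed.

Lemma basis_card_ge B X : basis B -> indep M X -> #|X| <= #|B|.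
Proof.
case/maxsetP=> iB maxB iX; rewrite leqNgt; apply/negP=> lt.
have [y /setDP[_ yB] iyB] := indep_aug iB iX lt.
by move: yB; rewrite -(maxB _ iyB (subsetUr _ _)) setU11.
Qed.

Lemma indep_basis B X : basis B -> indep M X -> #|X| = #|B| -> basis X.
Proof.
move=> bB iX cX; apply/maxsetP; split=> // Y iY sXY.
by apply/esym/eqP; rewrite eqEcard sXY cX basis_card_ge.
Qed.

Lemma basis_exists : exists B, basis B.
Proof.
by have [B mB _] := maxset_exists (indep0 M); exists B.
Qed.

Definition dual_indep : pred {set T} :=
  fun X => [exists B, basis B && (X \subset ~: B)].

Lemma dual_indep0 : dual_indep set0.
Proof.
by have [B bB] := basis_exists; apply/existsP; exists B; rewrite bB sub0set.
Qed.

Lemma dual_indep_sub X Y : X \subset Y -> dual_indep Y -> dual_indep X.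
Proof.
move=> sXY /existsP[B /andP[bB sY]]; apply/existsP; exists B.
by rewrite bB (subset_trans sXY).
Qed.

Lemma dual_indep_aug X Y : dual_indep X -> dual_indep Y -> #|X| < #|Y| ->
  exists2 y, y \in Y :\: X & dual_indep (y |: X).
Proof.
move=> /existsP[B /andP[bB sXB]] /existsP[B' /andP[bB' sYB']] ltXY.
have iB : indep M B by case/maxsetP: bB.
have iB' : indep M B' by case/maxsetP: bB'.
have iD : indep M (B' :\: X) by apply: indep_sub iB'; apply: subsetDl.
have [Z [sDZ sZ iZ cZ]] := indep_extend iD iB (basis_card_ge bB iD).
have bZ := indep_basis bB iZ cZ.
have sXZ : X \subset ~: Z.
  apply/subsetP=> x xX; rewrite inE; apply/negP=> /(subsetP sZ).
  rewrite !inE xX /=; apply/negP.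
  by have := subsetP sXB _ xX; rewrite inE.
have [sYZ|] := boolP (Y :\: X \subset Z); last first.
  case/subsetPn=> y yYX yZ; exists y => //; apply/existsP; exists Z.
  by rewrite bZ subUset sub1set inE yZ.
have sub1 : Y :\: X \subset Z :\: (B' :\: X).
  apply/subsetP=> y yYX; rewrite !inE (subsetP sYZ) // andbT.
  case/setDP: yYX => yY ->; have := subsetP sYB' _ yY.
  by rewrite inE.
have sub2 : B' :&: X \subset X :\: Y.
  apply/subsetP=> x /setIP[xB' xX]; rewrite !inE xX andbT.
  by apply/negP=> /(subsetP sYB'); rewrite inE xB'.
have cBB' : #|B| = #|B'| by apply/eqP; rewrite eqn_leq !basis_card_ge.
have c1 : #|Z :\: (B' :\: X)| = #|B' :&: X|.
  rewrite cardsD (setIidPr sDZ) cZ cBB' -(cardsID X B').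
  by rewrite addnK.
have := leq_trans (subset_leq_card sub1) (eq_leq c1).
move/leq_trans/(_ (subset_leq_card sub2)) => le.
move: ltXY; rewrite -(cardsID Y X) -(cardsID X Y) setIC ltn_add2l ltnNge.
by rewrite le.
Qed.

Definition dual : matroid T :=
  Matroid dual_indep0 dual_indep_sub dual_indep_aug.

End MatroidTheory.

Lemma basis_dual (T : finType) (M : matroid T) (B : {set T}) :
  basis (dual M) B = basis M (~: B).
Proof.
apply/maxsetP/idP=> [[/existsP[B' /andP[bB' sB]] maxB]|bB].
  rewrite -(maxB (~: B')) ?setCK //.
  by apply/existsP; exists B'; rewrite bB' subxx.
split; first by apply/existsP; exists (~: B); rewrite bB setCK subxx.
move=> X /existsP[B' /andP[bB' sX]] sBX; apply/eqP.
rewrite eqEsubset sBX andbT.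
have iB : indep M (~: B) by case/maxsetP: bB.
have [_ maxB'] := maxsetP bB'.
have sB'B : B' \subset ~: B by rewrite subsetC; apply: subset_trans sX.
by rewrite -(setCK B) (maxB' _ iB sB'B).
Qed.

Definition cocircuit (T : finType) (M : matroid T) (C : {set T}) : bool :=
  circuit (dual M) C.

(* A multiset of r subsets of T is an indexed family A : {ffun 'I_r -> _}.   *)
(* The matching is defined on the elements of X only, so that set0 is a      *)
(* partial transversal even when r = 0.                                      *)
Definition partial_transversal (T : finType) (r : nat)
    (A : {ffun 'I_r -> {set T}}) (X : {set T}) : Prop :=
  exists2 phi : {x : T | x \in X} -> 'I_r,
    injective phi & forall x, val x \in A (phi x).

(* M = M[A] *)
Definition presentation (T : finType) (M : matroid T) (r : nat)
    (A : {ffun 'I_r -> {set T}}) : Prop :=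
  forall X : {set T}, indep M X <-> partial_transversal A X.

Definition contains (T : finType) (r : nat) (A A' : {ffun 'I_r -> {set T}}) :=
  forall i, A' i \subset A i.

(* When A contains A', the two are equal as multisets only if A' = A (compare *)
(* the sums of the cardinalities), so "other" can be read on the families.    *)
Definition minimal_presentation (T : finType) (M : matroid T) (r : nat)
    (A : {ffun 'I_r -> {set T}}) : Prop :=
  presentation M A /\
  forall A' : {ffun 'I_r -> {set T}},
    presentation M A' -> contains A A' -> A' = A.

Definition cyclic_perm (T : finType) (sigma : {perm T}) : Prop :=
  forall x y : T, y \in porbit sigma x.

(* {f, sigma f, ..., l} *)
Definition interval (T : finType) (sigma : {perm T}) (f l : T) : {set T} :=
  [set x in traject sigma f (findex sigma f l).+1].

Definition is_interval (T : finType) (sigma : {perm T}) (A : {set T}) : Prop :=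
  exists f l : T, A = interval sigma f l.

Definition antichain (T : finType) (r : nat) (A : {ffun 'I_r -> {set T}}) :=
  forall i j : 'I_r, i != j -> ~~ (A i \subset A j).

Definition interval_presentation (T : finType) (M : matroid T)
    (sigma : {perm T}) (r : nat) (A : {ffun 'I_r -> {set T}}) : Prop :=
  [/\ presentation M A, antichain A & forall i, is_interval sigma (A i)].

Definition minimal_interval_presentation (T : finType) (M : matroid T)
    (sigma : {perm T}) (r : nat) (A : {ffun 'I_r -> {set T}}) : Prop :=
  interval_presentation M sigma A /\
  forall A' : {ffun 'I_r -> {set T}},
    interval_presentation M sigma A' -> contains A A' -> A' = A.

Definition multi_path_matroid (T : finType) (M : matroid T) : Prop :=
  exists (sigma : {perm T}) (r : nat) (A : {ffun 'I_r -> {set T}}),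
    cyclic_perm sigma /\ interval_presentation M sigma A.

(* Main.v *)
(** Let [n] be the size of the ground set.  In an antichain of [r] intervals the
    first elements are distinct, so the rank is [r].  Two facts give the
    theorem.
    - Trimming every interval to its first [n - r + 1] elements keeps the family
      an antichain and does not change the matroid: cut the cycle at a point
      from which the [k]-th element of a basis never precedes the [k]-th first
      element (cycle lemma); matching the two in this order respects the
      intervals by pigeonhole, and the [k]-th element is at distance at most
      [n - r] from its first element.  Hence in a minimal presentation all
      intervals have at most [n - r + 1] elements.
    - If [I i] has at most [n - r + 1] elements, enough room is left outside
      it to represent the other intervals there, so every [x] in [I i] lies in
      a basis meeting [I i] only in [x]; this makes [I i] a cocircuit.
    In any presentation of a matroid of rank [r] by [r] sets, every member meets
    every basis, so a cocircuit cannot be replaced by a proper subset. *)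

Require Import Defs.
From HB Require Import structures.
From mathcomp Require Import all_boot all_fingroup.
From mathcomp Require Import zify.

Set Implicit Arguments.
Unset Strict Implicit.
Unset Printing Implicit Defensive.

Lemma card_le_range (I : finType) (P : pred I) (g : I -> nat) (a b : nat) :
  {in P &, injective g} -> (forall i, P i -> a <= g i < b) -> #|P| <= b - a.
Proof.
move=> gI gP; rewrite cardE -(size_map g) -(size_iota a (b - a)).
apply: uniq_leq_size => [|_ /mapP[i + ->]].
  rewrite map_inj_in_uniq ?enum_uniq // => i j.
  by rewrite !mem_enum; apply: gI.
by rewrite mem_enum => /gP ?; rewrite mem_iota; lia.
Qed.

(** * Distances and arcs on a cycle *)

Section CyclicOrder.

Variables (T : finType) (sigma : {perm T}).
Hypothesis sigma_cyclic : cyclic_perm sigma.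
Local Notation n := #|T|.
Local Notation d := (findex sigma).

Lemma fconnect_cyclic x y : fconnect sigma x y.
Proof.
have /porbitP[i ->] := sigma_cyclic x y.
by rewrite permX fconnect_iter.
Qed.

Lemma order_cyclic x : fingraph.order sigma x = n.
Proof. by apply: eq_card => y; rewrite !inE; apply: fconnect_cyclic. Qed.

Lemma iter_cyclic_findex x y : iter (d x y) sigma x = y.
Proof. exact/iter_findex/fconnect_cyclic. Qed.

Lemma findex_cyclic_lt x y : d x y < n.
Proof. by rewrite -(order_cyclic x); apply/findex_max/fconnect_cyclic. Qed.

Lemma findex_cyclic_iter x i : i < n -> d x (iter i sigma x) = i.
Proof. by move=> lt_in; apply: findex_iter; rewrite order_cyclic. Qed.

Lemma findex_cyclic_inj x : injective (d x).
Proof.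
by move=> y z dyz; rewrite -(iter_cyclic_findex x y) dyz iter_cyclic_findex.
Qed.

(** Measuring every distance from one cut [z] turns cyclic statements into linear arithmetic. *)
Lemma findex_cyclic_shift z x y :
  d x y = if d z x <= d z y then d z y - d z x else d z y + n - d z x.
Proof.
have ltx := findex_cyclic_lt z x; have lty := findex_cyclic_lt z y.
case: leqP => le_xy.
  rewrite -{1}(iter_cyclic_findex z y) -{1}(subnK le_xy) iterD.
  by rewrite iter_cyclic_findex findex_cyclic_iter; lia.
have n_iter : iter n sigma z = z.
  by rewrite -(order_cyclic z) iter_order //; apply: perm_inj.
have {1}-> : y = iter (d z y + n - d z x) sigma x.
  rewrite -{2}(iter_cyclic_findex z x) -iterD subnK; last by lia.
  by rewrite iterD n_iter iter_cyclic_findex.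
by rewrite findex_cyclic_iter; lia.
Qed.

(* The parameter [m] is one less than the number of elements. *)
Definition arc (f : T) (m : nat) : {set T} := [set x | d f x <= m].

Lemma in_arc f m x : (x \in arc f m) = (d f x <= m).
Proof. by rewrite inE. Qed.

Lemma intervalE f l : interval sigma f l = arc f (d f l).
Proof.
apply/setP=> x; rewrite in_arc inE; apply/trajectP/idP => [[i lti ->]|lex].
  by rewrite findex_cyclic_iter //; have := findex_cyclic_lt f l; lia.
by exists (d f x); rewrite ?ltnS // iter_cyclic_findex.
Qed.

Lemma arc_is_interval f m : m < n -> is_interval sigma (arc f m).
Proof.
move=> ltm; exists f, (iter m sigma f).
by rewrite intervalE findex_cyclic_iter.
Qed.

Lemma arc_subset f m f' m' : m < n -> m' < n ->
  (arc f m \subset arc f' m') = (m' == n.-1) || (d f' f + m <= m').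
Proof.
move=> ltm ltm'; have ltf := findex_cyclic_lt f' f.
apply/idP/idP => [sub|/orP sub].
  have [//|neq /=] := eqVneq m' n.-1.
  (* This picks the last element of the arc at [f] before the walk returns to [f']. If the minimum
     is the second term, its distance from [f'] is [n.-1], which only a full arc allows. *)
  pose k := minn m (n.-1 - d f' f).
  have ltk : k < n by lia.
  have := subsetP sub (iter k sigma f); rewrite !in_arc findex_cyclic_iter //.
  rewrite -[f in d f' (iter _ _ f)](iter_cyclic_findex f') -iterD.
  by rewrite findex_cyclic_iter; lia.
apply/subsetP=> x; rewrite !in_arc (findex_cyclic_shift f' f x).
by have := findex_cyclic_lt f' x; case: ifP; case: sub => [/eqP|]; lia.
Qed.

(** * Counting points along a cut cycle *)

Section Rank.

Variables (r : nat) (g : 'I_r -> T).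

Definition below z c := #|[pred j | d z (g j) < c]|.

Lemma below_full z c : n <= c -> below z c = r.
Proof.
move=> len; rewrite -[RHS]card_ord; apply: eq_card => j; rewrite !inE.
exact: leq_trans (findex_cyclic_lt _ _) len.
Qed.

Lemma below_le z c : below z c <= r.
Proof. by rewrite -[leqRHS]card_ord max_card. Qed.

(** The first [c] places from [z'] continue the first [d z z'] places from [z]. Once they run past
    [z], every index counts once and those in the overlap once more. *)
Lemma below_shift z z' c : c < n ->
  below z' c + below z (d z z') =
    if d z z' + c < n then below z (d z z' + c)
    else r + below z (d z z' + c - n).
Proof.
move=> ltc; have ltz := findex_cyclic_lt z z'.
have E j : d z' (g j) < c = if d z z' + c < n
    then d z z' <= d z (g j) < d z z' + c
    else (d z z' <= d z (g j)) || (d z (g j) < d z z' + c - n).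
  rewrite (findex_cyclic_shift z z'); have := findex_cyclic_lt z (g j).
  by do 2!case: ifP; lia.
have indic (P : pred 'I_r) : #|P| = \sum_j P j.
  rewrite -sum1_card big_mkcond; apply: eq_bigr => j _.
  by rewrite unfold_in; case: (P j).
rewrite /below !indic -big_split /=; case: ifP => [lt|ge] /=.
  by apply: eq_bigr => j _; rewrite E lt; lia.
have r_sum : r = \sum_(j < r) 1 by rewrite sum1_card card_ord.
rewrite [X in _ = X + _]r_sum -big_split /=.
apply: eq_bigr => j _; rewrite E ge; have := findex_cyclic_lt z (g j).
by case: leqP => ?; case: ltnP => ? ?; lia.
Qed.

Hypothesis g_inj : injective g.
Variable z : T.

Definition rank i := below z (d z (g i)).

Lemma rank_mono i j : d z (g i) < d z (g j) -> rank i < rank j.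
Proof.
move=> ltij; apply: proper_card; apply/properP; split.
  by apply/subsetP=> k; rewrite !inE => /ltn_trans; apply.
by exists i; rewrite !inE ?ltnn.
Qed.

Lemma dist_total i j : i != j ->
  d z (g i) < d z (g j) \/ d z (g j) < d z (g i).
Proof.
move=> neq; case: (ltngtP (d z (g i)) (d z (g j))); auto.
by move/findex_cyclic_inj/g_inj/eqP; rewrite (negbTE neq).
Qed.

Lemma belowS i : below z (d z (g i)).+1 = (rank i).+1.
Proof.
rewrite /below (cardD1 i) inE ltnSn; congr _.+1; apply: eq_card => j.
rewrite !inE; have [->|/dist_total] := eqVneq j i; [by rewrite ltnn | lia].
Qed.

Lemma rank_lt i : rank i < r.
Proof. by rewrite -belowS below_le. Qed.

Lemma rank_inj : injective (fun i => Ordinal (rank_lt i)).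
Proof.
move=> i j /(congr1 val) /= E; apply/eqP; apply/negPn/negP=> /dist_total.
by case=> /rank_mono; rewrite E ltnn.
Qed.

Lemma rank_le_dist i : rank i <= d z (g i).
Proof.
rewrite -(subn0 (d z (g i))).
apply: (@card_le_range _ _ (fun j => d z (g j))) => //.
by move=> j k _ _ /findex_cyclic_inj/g_inj.
Qed.

(** The values of [g] after [g i] need distinct places among those that remain before the cycle
    closes. *)
Lemma dist_le_rank i : d z (g i) + r <= n + rank i.
Proof.
pose P := [pred j | d z (g j) < (d z (g i)).+1].
have leC : #|[predC P]| <= n - (d z (g i)).+1.
  apply: (@card_le_range _ _ (fun j => d z (g j))) => [j k _ _|j].
    by move/findex_cyclic_inj/g_inj.
  by rewrite /= findex_cyclic_lt andbT -leqNgt.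
have := cardC P; rewrite card_ord -[#|P|]/(below z _) belowS.
by move: leC (findex_cyclic_lt z (g i)); set k := #|[predC P]|; lia.
Qed.

End Rank.

(* Cycle lemma: cut where the surplus of [g] over [h] is maximal. *)
Lemma good_cut r (g h : 'I_r -> T) : 0 < n ->
  exists z, forall c, below g z c <= below h z c.
Proof.
case/card_gt0P=> z0 _.
(* The surplus is raised by [r] so that it stays a natural number. *)
pose s c := below g z0 c + (r - below h z0 c).
have n0 : 0 < n by apply/card_gt0P; exists z0.
case: (@arg_maxnP _ (Ordinal n0) xpredT (fun c : 'I_n => s c)) => // c _ cmax.
pose z := iter c sigma z0; exists z => c'.
have [le|lt] := leqP n c'; first by rewrite !below_full.
have dz : d z0 z = c by rewrite findex_cyclic_iter.
have := below_shift g z0 z lt; have := below_shift h z0 z lt; rewrite dz.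
have le k : below h z0 k <= r by apply: below_le.
case: ifP => [ltcc|].
  have := cmax (Ordinal ltcc) isT; rewrite /s /=.
  by have := le c; have := le (c + c'); lia.
have ltcc : c + c' - n < n by have := ltn_ord c; lia.
have := cmax (Ordinal ltcc) isT; rewrite /s /=.
move: (le c) (le (c + c' - n)).
set hc := below h z0 c; set hk := below h z0 (_ - n).
by set gc := below g z0 c; set gk := below g z0 (_ - n); lia.
Qed.

(** * Antichains of arcs and their transversals *)

Section ArcFamily.

Variables (r : nat) (f : 'I_r -> T) (m : 'I_r -> nat).
Hypothesis lt_m : forall i, m i < n.
Hypothesis arc_antichain :
  forall i j, i != j -> ~~ (arc (f i) (m i) \subset arc (f j) (m j)).

Lemma arc_antichain_lt i j : i != j ->
  m j < n.-1 /\ m j < d (f j) (f i) + m i.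
Proof.
by move/arc_antichain; rewrite arc_subset //; have := lt_m j; lia.
Qed.

Lemma arc_first_inj : injective f.
Proof.
move=> i j fij; apply/eqP; apply/negPn/negP=> neq.
have dff x : d x x = 0 by rewrite (findex_cyclic_shift x) leqnn subnn.
have [_] := arc_antichain_lt neq; rewrite eq_sym in neq.
by have [_] := arc_antichain_lt neq; rewrite fij dff; lia.
Qed.

Lemma arc_first_dist i j : i != j -> 0 < d (f i) (f j).
Proof.
move=> neq; rewrite lt0n; apply/eqP=> d0.
case/eqP: neq; apply: arc_first_inj.
by rewrite -(iter_cyclic_findex (f i) (f j)) d0.
Qed.

Lemma card_arc_family : r <= n.
Proof. by rewrite -[r in r <= _]card_ord; apply/leq_card/arc_first_inj. Qed.

Section Cut.

Variable z : T.

(** Otherwise arc [j] would lie inside arc [i]. Last places are not reduced modulo [n], so this also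
    covers arcs running through [z]. *)
Lemma arc_last_lt i j : d z (f i) < d z (f j) ->
  d z (f i) + m i < d z (f j) + m j.
Proof.
move=> ltij; have neq : j != i by apply: contraTneq ltij => ->; rewrite ltnn.
have [_] := arc_antichain_lt neq; rewrite (findex_cyclic_shift z).
by case: ifP; lia.
Qed.

Lemma in_arc_cut i q : d z (f i) <= q <= d z (f i) + m i -> q < n ->
  iter q sigma z \in arc (f i) (m i).
Proof.
move=> leq ltq; rewrite in_arc (findex_cyclic_shift z) findex_cyclic_iter //.
by case: ifP; lia.
Qed.

End Cut.

(* Greedily place the other representatives strictly after the arc [i], in
   the cyclic order starting at [f i]. *)
Lemma transversal_meeting_arc_once i x : x \in arc (f i) (m i) ->
    m i <= n - r ->
  exists psi : 'I_r -> T,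
    [/\ injective psi, forall j, psi j \in arc (f j) (m j)
      & forall j, psi j \in arc (f i) (m i) -> psi j = x].
Proof.
move=> xi lemi; have lern := card_arc_family.
have lt_rk := rank_lt arc_first_inj (f i).
(* Arc [i] fills the places up to [m i]. The arc of rank [k] gets place [m i + k], or its own first
   place if that is later; [k < r] and [m i <= n - r] keep this below [n]. *)
pose z := f i; pose q j := maxn (m i + rank f z j) (d z (f j)).
have dzz : d z (f i) = 0 by rewrite (findex_cyclic_shift z) leqnn subnn.
have rk_gt0 j : j != i -> 0 < rank f z j.
  rewrite eq_sym => /arc_first_dist; rewrite -/z -{1}dzz => /rank_mono.
  by apply: leq_trans.
have q_lt j : q j < n.
  have := findex_cyclic_lt z (f j); have := lt_rk j; rewrite /q /z; lia.
have q_mono j k : d z (f j) < d z (f k) -> q j < q k.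
  by move=> lt; have := rank_mono lt; rewrite /q; lia.
have q_le j : q j <= d z (f j) + m j.
  (* The arcs starting before arc [j] have distinct last places, all at least [m i] and before the
     last place of [j]. *)
  have rkj : rank f z j <= (d z (f j) + m j) - m i.
    apply: (@card_le_range _ _ (fun k => d z (f k) + m k)) => /= [k l _ _ E|k].
      apply/eqP; apply/negPn/negP=> /(dist_total arc_first_inj z).
      by case=> /arc_last_lt; rewrite E ltnn.
    move=> /arc_last_lt ->; rewrite andbT.
    have [->|] := eqVneq k i; first by rewrite dzz.
    rewrite eq_sym => /arc_first_dist; rewrite -/z -{1}dzz => /arc_last_lt.
    by rewrite dzz; lia.
  rewrite /q geq_max leq_addr andbT.
  have [->|neq] := eqVneq j i; last first.
    by move: neq => /rk_gt0; lia.
  have : rank f z i <= 0 by rewrite -dzz; apply/rank_le_dist/arc_first_inj.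
  by lia.
have out j : j != i -> iter (q j) sigma z \notin arc (f i) (m i).
  by move/rk_gt0; rewrite in_arc findex_cyclic_iter // /q; lia.
exists (fun j => if j == i then x else iter (q j) sigma z); split.
- move=> j k /=; have [->|nj] := eqVneq j i; have [->|nk] := eqVneq k i => //.
  + by move=> E; case/negP: (out _ nk); rewrite -E.
  + by move=> E; case/negP: (out _ nj); rewrite E.
  move/(congr1 (d z)); rewrite !findex_cyclic_iter // => E.
  apply/eqP; apply/negPn/negP=> /(dist_total arc_first_inj z).
  by case=> /q_mono; rewrite E ltnn.
- move=> j; have [->//|_] := eqVneq j i.
  by apply: in_arc_cut => //; rewrite q_le leq_maxr.
move=> j; have [//|/out] := eqVneq j i.
by move=> /negbTE ->.
Qed.

Lemma transversal_trim (psi : 'I_r -> T) : injective psi ->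
    (forall i, psi i \in arc (f i) (m i)) ->
  exists psi' : 'I_r -> T,
    [/\ injective psi', psi' @: 'I_r = psi @: 'I_r
      & forall i, psi' i \in arc (f i) (minn (m i) (n - r))].
Proof.
move=> psi_inj psiP.
case: (posnP n) => [n0|/(good_cut psi f)[z cut]].
  exists psi; split=> // i.
  by have := max_card (pred1 (psi i)); rewrite card1 n0.
have rk_inj := @rank_inj _ _ psi_inj z.
(* [e] pairs first elements and values of [psi] of equal rank from [z]. *)
pose e i := invF rk_inj (Ordinal (rank_lt arc_first_inj z i)).
have eP i : rank psi z (e i) = rank f z i.
  have /(congr1 val) := f_invF rk_inj (Ordinal (rank_lt arc_first_inj z i)).
  by [].
have e_inj : injective e.
  by move=> i j /(can_inj (f_invF _)) /rank_inj.
exists (psi \o e); split; first exact: inj_comp.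
  apply/eqP; rewrite eqEcard !card_imset ?leqnn ?andbT //; last exact: inj_comp.
  by apply/subsetP=> _ /imsetP[i _ ->]; apply: imset_f.
move=> i; pose b := d z (psi (e i)); have lt_b : b < n := findex_cyclic_lt _ _.
(* Otherwise the first [b.+1] places would hold more values of [psi] than first elements, against
   [cut]. *)
have le_fb : d z (f i) <= b.
  rewrite leqNgt; apply/negP=> lt_bf; have := cut b.+1.
  rewrite belowS // eP ltnNge => /negP[]; apply: subset_leq_card.
  by apply/subsetP=> j; rewrite !inE => /leq_trans; apply.
(* If [b] lay past arc [i], all arcs starting no later than [f i] would have their values of [psi]
   before [b]: one more than the rank of [psi (e i)] permits. *)
have le_bl : b <= d z (f i) + m i.
  rewrite leqNgt; apply/negP=> lt_lb.
  suff : below f z (d z (f i)).+1 <= below psi z b.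
    rewrite belowS; last exact: arc_first_inj.
    by rewrite -/(rank psi z (e i)) eP ltnn.
  apply: subset_leq_card; apply/subsetP=> j; rewrite !inE ltnS => le_ji.
  have le_last : d z (f j) + m j <= d z (f i) + m i.
    have [->//|/(dist_total arc_first_inj z)] := eqVneq j i.
    by case=> [/arc_last_lt/ltnW//|]; rewrite ltnNge le_ji.
  have := psiP j; rewrite in_arc (findex_cyclic_shift z).
  by have := findex_cyclic_lt z (psi j); case: ifP; lia.
(* With the common rank cancelled, [lo] and [hi] bound [b - d z (f i)] by [n - r]. *)
have /= lo := rank_le_dist arc_first_inj z i.
have := dist_le_rank psi_inj z (e i); rewrite eP -/b => hi.
rewrite in_arc (findex_cyclic_shift z) -/b le_fb.
(* [set] identifies occurrences of [#|T|] that [lia] takes for different atoms. *)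
by move: hi; set N := #|T|; lia.
Qed.

End ArcFamily.

End CyclicOrder.

(** * Partial transversals of full size *)

Section Transversals.

Variables (T : finType) (r : nat).
Implicit Types (A : {ffun 'I_r -> {set T}}) (X : {set T}).

Lemma partial_transversal_sub A A' X :
  contains A A' -> partial_transversal A' X -> partial_transversal A X.
Proof.
by move=> sA [phi inj phiP]; exists phi => // x; apply: (subsetP (sA _)).
Qed.

Lemma partial_transversal_card A X : partial_transversal A X -> #|X| <= r.
Proof.
case=> phi inj _; rewrite -[r]card_ord -card_sig; exact: leq_card inj.
Qed.

(** A matching of [r] elements into [r] indices is bijective, so it can be inverted. *)
Lemma partial_transversal_imset A X : #|X| = r ->
  partial_transversal A X <->
  exists psi : 'I_r -> T,
    [/\ injective psi, psi @: 'I_r = X & forall i, psi i \in A i].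
Proof.
move=> cX; split=> [[phi inj phiP]|[psi [inj im psiP]]].
  have bij : bijective phi.
    by apply: inj_card_bij; rewrite // card_sig cX card_ord.
  case: bij => psi phiK psiK; exists (fun i => val (psi i)); split.
  - by move=> i j /val_inj /(can_inj psiK).
  - apply/setP=> x; apply/imsetP/idP => [[i _ ->]|xX].
      exact: (valP (psi i)).
    by exists (phi (exist _ x xX)); rewrite ?phiK.
  by move=> i; have := phiP (psi i); rewrite psiK.
have ex (x : {x | x \in X}) : exists i, psi i == val x.
  have /imsetP[i _ ->] : val x \in psi @: 'I_r by rewrite im (valP x).
  by exists i.
exists (fun x => xchoose (ex x)) => [x y E|x].
  apply: val_inj; rewrite -(eqP (xchooseP (ex x))) -(eqP (xchooseP (ex y))).
  by rewrite E.
by rewrite -{1}(eqP (xchooseP (ex x))).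
Qed.

End Transversals.

(** * Presentations, bases and dual dependence *)

Section Presentations.

Variables (T : finType) (M : matroid T) (r : nat).
Implicit Types (A : {ffun 'I_r -> {set T}}) (B : {set T}).

Lemma eq_card_basis B B' : basis M B -> basis M B' -> #|B| = #|B'|.
Proof.
move=> bB bB'; have [iB _] := maxsetP bB; have [iB' _] := maxsetP bB'.
by apply/eqP; rewrite eqn_leq (basis_card_ge bB') // (basis_card_ge bB).
Qed.

Lemma transversal_basis A (psi : 'I_r -> T) : presentation M A ->
  injective psi -> (forall i, psi i \in A i) -> basis M (psi @: 'I_r).
Proof.
move=> pA inj psiP.
have c : #|psi @: 'I_r| = r by rewrite card_imset // card_ord.
apply/maxsetP; split=> [|B iB sub].
  by apply/pA/(partial_transversal_imset _ c); exists psi.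
apply/esym/eqP; rewrite eqEcard sub c.
by move/pA: iB; apply: partial_transversal_card.
Qed.

Lemma basis_transversal A B : presentation M A -> basis M B -> #|B| = r ->
  exists psi : 'I_r -> T,
    [/\ injective psi, psi @: 'I_r = B & forall i, psi i \in A i].
Proof.
move=> pA /maxsetP[iB _] cB.
by apply/(partial_transversal_imset _ cB)/pA.
Qed.

(** A basis of [r] elements takes a representative from every member, so no member fits in its
    complement. *)
Lemma presentation_dual_dep A B0 : presentation M A -> basis M B0 ->
  #|B0| = r -> forall i, ~~ dual_indep M (A i).
Proof.
move=> pA bB0 cB0 i; apply/existsP=> -[B /andP[bB sub]].
have cB : #|B| = r by rewrite (eq_card_basis bB bB0).
have [psi [_ im psiP]] := basis_transversal pA bB cB.
have := subsetP sub _ (psiP i).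
by rewrite inE -im imset_f.
Qed.

(** A matching of a basis restricts to each independent set inside it. *)
Lemma presentation_sub_bases A A' : presentation M A -> contains A A' ->
  (forall B, basis M B -> partial_transversal A' B) -> presentation M A'.
Proof.
move=> pA sA basisP X; split=> [iX|]; last first.
  by move/(partial_transversal_sub sA)/pA.
have [B mB sXB] := maxset_exists iX.
have [phi inj phiP] := basisP _ mB.
exists (fun x => phi (exist _ (val x) (subsetP sXB _ (valP x)))) => [x y|x].
  by move/inj/(congr1 val) => /= E; apply: val_inj.
exact: phiP (exist _ _ _).
Qed.

Lemma cocircuits_minimal_presentation A B0 : presentation M A ->
  basis M B0 -> #|B0| = r ->
  (forall i, cocircuit M (A i)) -> minimal_presentation M A.
Proof.
move=> pA bB0 cB0 coc; split=> // A' pA' sA; apply/ffunP=> i.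
have /minsetP[_ min] := coc i; apply: min (sA i).
exact: presentation_dual_dep pA' bB0 cB0 i.
Qed.

End Presentations.

Theorem theorem6p4 (T : finType) (M : matroid T) (sigma : {perm T})
    (r : nat) (I : {ffun 'I_r -> {set T}}) :
  multi_path_matroid M -> cyclic_perm sigma ->
  minimal_interval_presentation M sigma I ->
  (forall i : 'I_r, cocircuit M (I i)) /\ minimal_presentation M I.
Proof.
move=> _ cyc [[pI antiI intI] minI].
have [f [m IE]] : exists f m, forall i,
    I i = arc sigma (f i) (m i) /\ m i < #|T|.
  have /fin_all_exists[f fP] : forall i, exists f, exists m,
      I i = arc sigma f m /\ m < #|T|.
    move=> i; have [f [l ->]] := intI i; exists f, (findex sigma f l).
    by rewrite intervalE // findex_cyclic_lt.
  by have /fin_all_exists[m mP] := fP; exists f, m.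
have lt_m i : m i < #|T| by have [] := IE i.
have {}IE i : I i = arc sigma (f i) (m i) by have [] := IE i.
have anti i j : i != j ->
    ~~ (arc sigma (f i) (m i) \subset arc sigma (f j) (m j)).
  by rewrite -!IE; apply: antiI.
have f_inj := arc_first_inj cyc lt_m anti.
have fP i : f i \in I i.
  by rewrite IE in_arc (findex_cyclic_shift cyc (f i)) leqnn subnn.
have bF := transversal_basis pI f_inj fP.
have cF : #|f @: 'I_r| = r by rewrite card_imset // card_ord.
pose m' i := minn (m i) (#|T| - r).
pose I' := [ffun i => arc sigma (f i) (m' i)].
have sI : contains I I'.
  move=> i; rewrite ffunE IE; apply/subsetP=> x; rewrite !in_arc /m'; lia.
have lt_m' i : m' i < #|T| by have := lt_m i; rewrite /m'; lia.
have I'I : I' = I.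
  apply: minI => //; split.
  - apply: (presentation_sub_bases pI sI) => B bB.
    have cB : #|B| = r by rewrite (eq_card_basis bB bF).
    have [psi [inj im psiP]] := basis_transversal pI bB cB.
    have [i|psi' [inj' im' psiP']] := transversal_trim cyc lt_m anti inj.
      by rewrite -IE.
    apply/(partial_transversal_imset _ cB); exists psi'.
    by split=> [//||i]; [rewrite im' | rewrite ffunE; apply: psiP'].
  (* If [m' i] is [m i], the old antichain condition suffices; if it is [#|T| - r], then [m' j] is
     no larger and the positive distance from [f j] to [f i] decides. *)
  - move=> i j neq; rewrite !ffunE arc_subset //.
    have [] := arc_antichain_lt cyc lt_m anti neq.
    rewrite eq_sym in neq; have := arc_first_dist cyc lt_m anti neq.
    by rewrite /m'; lia.
  by move=> i; rewrite ffunE; apply: arc_is_interval.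
have le_m i : m i <= #|T| - r.
  have : arc sigma (f i) (m i) \subset arc sigma (f i) (m' i).
    by have := congr1 (fun A : {ffun _} => A i) I'I; rewrite ffunE IE => ->.
  have lt_r : 0 < r by case: (i) => k; lia.
  by rewrite arc_subset // => /orP[]; have := lt_m i; rewrite /m'; lia.
suff coc i : cocircuit M (I i).
  by split=> //; apply: cocircuits_minimal_presentation pI bF cF coc.
apply/minsetP; split=> [|Y depY sY].
  exact: presentation_dual_dep pI bF cF i.
apply/eqP; rewrite eqEsubset sY; apply/subsetP=> x xI.
(* A subset of [I i] missing [x] avoids a basis that meets [I i] at most in [x], so it is
   independent in the dual. *)
apply: contraR depY => xY.
have xA : x \in arc sigma (f i) (m i) by rewrite -IE.
have [psi [inj psiP only]] :=
  transversal_meeting_arc_once cyc lt_m anti xA (le_m i).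
apply/existsP; exists (psi @: 'I_r); apply/andP; split.
  by apply: transversal_basis pI inj _ => j; rewrite IE.
apply/subsetP=> y yY; rewrite inE; apply/negP=> /imsetP[j _ yj].
have := only j; rewrite -IE -yj => /(_ (subsetP sY _ yY)) yx.
by rewrite -yx yY in xY.
Qed.
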